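(* Let $G$ be a countable, discrete group. The following are equivalent. (1) There is a sequence $(\varphi_n)$ of functions $\varphi_n: G\to\mathbb{C}$ vanishing at infinity such that $\varphi_n\to 1$ pointwise and $\|\varphi_n\|_{B_2}\leq 1$ for all $n$. (2) There is a function $\varphi: G\to\mathbb{R}$ such that $\varphi$ is proper and $\|e^{-t\varphi}\|_{B_2}\leq 1$ for every $t>0$.
   Context: A kernel $k:X\times X\to\mathbb{C}$ on a non-empty set $X$ is a Schur multiplier if for every bounded operator $A=[a_{xy}]_{x,y\in X}$ on $\ell^2(X)$ the matrix $[k(x,y)a_{xy}]_{x,y\in X}$ represents a bounded operator $m_k(A)$ on $\ell^2(X)$; then $m_k$ is a bounded operator on $B(\ell^2(X))$ and $\|k\|_S=\|m_k\|$. A function $\varphi:G\to\mathbb{C}$ on a discrete group is a Herz-Schur multiplier if the kernel $\hat\varphi(x,y)=\varphi(y^{-1}x)$ is a Schur multiplier on $G$, and its norm is $\|\varphi\|_{B_2}=\|\hat\varphi\|_S$. The inequality $\|\varphi\|_{B_2}\le 1$ includes the assertion that $\varphi$ is a Herz-Schur multiplier. A function $\varphi:G\to\mathbb{R}$ is proper if $\{g\in G : |\varphi(g)|<n\}$ is finite for each $n\in\mathbb{N}$. *)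

(* Defs.v *)
From HB Require Import structures.
From mathcomp Require Import all_boot all_order all_algebra.
From mathcomp Require Import all_classical all_reals all_analysis.
From mathcomp Require Import ring complex.

Set Implicit Arguments.
Unset Strict Implicit.
Unset Printing Implicit Defensive.

Import Order.TTheory GRing.Theory Num.Theory.
Import numFieldNormedType.Exports.

Local Open Scope classical_set_scope.
Local Open Scope ring_scope.
Local Open Scope complex_scope.

(* The modulus of a complex number as an element of [R]; the library's [`|z|]
   lives in [R[i]]. *)
Notation cmod := ComplexField.Normc.normc.

Section Ell2.
Context {R : realType} {X : choiceType}.
Implicit Types f g : X -> R[i]^o.

(* The sum is an unordered one, so [X] may be uncountable. *)
Definition l2sq f : \bar R := \esum_(x in [set: X]) (cmod (f x) ^+ 2)%:E.

Definition square_summable : {pred X -> R[i]^o} :=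
  fun f => `[< (l2sq f < +oo)%E >].

Lemma square_summableP f :
  reflect (l2sq f < +oo)%E (f \in square_summable).
Proof. exact: asboolP. Qed.

Lemma cmod_ge0 (z : R[i]) : 0 <= cmod z.
Proof. by case: z => a b; exact: sqrtr_ge0. Qed.

Lemma square_summable_submod : submod_closed square_summable.
Proof.
have sq0 (z : R[i]) : (0 <= (cmod z ^+ 2)%:E)%E by rewrite lee_fin sqr_ge0.
split.
  apply/square_summableP; rewrite /l2sq esum1 ?ltry// => x _.
  by rewrite [cmod _]ComplexField.Normc.normc0 expr0n.
move=> a f g /square_summableP hf /square_summableP hg; apply/square_summableP.
have scale_esum (c : R) h : 0 <= c -> (l2sq h < +oo)%E ->
    (\esum_(x in [set: X]) (c * cmod (h x) ^+ 2)%:E < +oo)%E.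
  move=> c0 hh; apply: (@le_lt_trans _ _ (c%:E * l2sq h)%E); last first.
    by rewrite lte_mul_pinfty// lee_fin.
  apply: ge_ereal_sup => _ [A hA <-].
  under eq_fsbigr do rewrite EFinM.
  rewrite -ge0_mule_fsumr//; apply: lee_wpmul2l; first by rewrite lee_fin.
  by apply: ereal_sup_ubound; exists A.
pose c := cmod a ^+ 2 *+ 2.
have c0 : 0 <= c by rewrite mulrn_wge0// sqr_ge0.
have h1 := scale_esum c f c0 hf; have h2 := scale_esum 2 g (ler0n _ _) hg.
apply: (le_lt_trans _ (lte_add_pinfty h1 h2)).
have pos (d : R) h x : 0 <= d -> (0 <= (d * cmod (h x) ^+ 2)%:E)%E.
  by move=> d0; rewrite lee_fin mulr_ge0// sqr_ge0.
rewrite -esumD => [|x _|x _]; try exact: pos.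
apply: le_esum => x _; rewrite -EFinD lee_fin.
apply: (@le_trans _ _ ((cmod a * cmod (f x) + cmod (g x)) ^+ 2)).
  rewrite ler_sqr ?nnegrE ?addr_ge0 ?mulr_ge0 ?cmod_ge0//.
  by rewrite -ComplexField.Normc.normcM; exact: le_normcD.
rewrite -subr_ge0.
rewrite (_ : _ - _ = (cmod a * cmod (f x) - cmod (g x)) ^+ 2) ?sqr_ge0//.
by rewrite /c -[2]/(1 *+ 2) !mulrnAl mul1r sqrrD sqrrB exprMn; ring.
Qed.

HB.instance Definition _ :=
  GRing.isSubmodClosed.Build R[i] (X -> R[i]^o) square_summable
    square_summable_submod.

Record ell2 := Ell2 {
  ell2_val :> X -> R[i]^o;
  ell2P : ell2_val \in square_summable }.

HB.instance Definition _ := [isSub of ell2 for ell2_val].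
HB.instance Definition _ := [Choice of ell2 by <:].
HB.instance Definition _ := [SubChoice_isSubLmodule of ell2 by <:].

Definition l2norm (u : ell2) : R := Num.sqrt (fine (l2sq u)).

Lemma delta_square_summable (y : X) :
  (fun x => (x == y)%:R : R[i]^o) \in square_summable.
Proof.
apply/square_summableP; rewrite /l2sq.
rewrite (_ : esum _ _ = \esum_(x in [set y]) (1 : R)%:E).
  by rewrite esum_set1 ?ltry// lee_fin.
rewrite [RHS]esum_mkcond; apply: eq_esum => x _.
case: eqVneq => [->|xy]; first by rewrite mem_set// ComplexField.Normc.normc1 expr1n.
by rewrite memNset ?ComplexField.Normc.normc0 ?expr0n//= => /eqP; rewrite (negbTE xy).
Qed.

Definition delta (y : X) : ell2 := Ell2 (delta_square_summable y).

Record bop := Bop {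
  bop_fun :> {linear ell2 -> ell2};
  bop_bounded : exists c : R, forall u, l2norm (bop_fun u) <= c * l2norm u }.

Definition opnorm (A : bop) : R :=
  sup [set l2norm (A u) | u in [set u | l2norm u <= 1]].

Definition entry (A : bop) (x y : X) : R[i] := A (delta y) x.

Definition schur_multiplier (k : X -> X -> R[i]) : Prop :=
  forall A : bop, exists B : bop, forall x y, entry B x y = k x y * entry A x y.

(* [m_k]; a bounded operator is determined by its entries, so the choice made
   here is the only one possible. *)
Definition schur_op k (hk : schur_multiplier k) (A : bop) : bop :=
  projT1 (cid (hk A)).

(* The operator norm of [m_k] on B(ell^2(X)); the supremum is taken in the
   extended reals, so that no boundedness is presupposed. *)
Definition schur_norm k (hk : schur_multiplier k) : \bar R :=
  ereal_sup [set (opnorm (schur_op hk A))%:E | A in [set A | opnorm A <= 1]].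

End Ell2.
Arguments ell2 : clear implicits.
Arguments bop : clear implicits.

Section HerzSchur.
Context {R : realType} {G : groupType}.
Implicit Types phi : G -> R[i].

Definition hat_kernel phi (x y : G) : R[i] := phi (y^-1 * x)%g.

Definition herz_schur_multiplier phi := schur_multiplier (hat_kernel phi).

Definition B2norm phi (h : herz_schur_multiplier phi) : \bar R := schur_norm h.

Definition B2norm_le phi (c : R) : Prop :=
  exists h : herz_schur_multiplier phi, (B2norm h <= c%:E)%E.

Definition vanishing_at_infinity phi : Prop :=
  forall e : R, 0 < e -> finite_set [set g | e <= cmod (phi g)].

Definition proper_fun (phi : G -> R) : Prop :=
  forall n : nat, finite_set [set g | `|phi g| < n%:R].

End HerzSchur.

(* Main.v *)
From HB Require Import structures.
Require Import Defs.
From mathcomp Require Import all_boot all_order all_algebra.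
From mathcomp Require Import all_classical all_reals all_analysis.
From mathcomp Require Import finmap complex ring lra.
Import Order.TTheory GRing.Theory Num.Theory.
Import numFieldNormedType.Exports.
Local Open Scope classical_set_scope.
Local Open Scope ring_scope.
Local Open Scope complex_scope.

Set Implicit Arguments.
Unset Strict Implicit.
Unset Printing Implicit Defensive.

(** The kernels [k] with [schur_norm k <= 1] form a set that contains [1] and
is closed under products, complex conjugation, convex combinations and
pointwise limits; nothing else about Schur multipliers is used beyond the
bound [|k x y| <= 1].

These closure properties are immediate once Schur multiplication is described
by finite sections.  Say that a matrix [a] is bounded by [c] ([mxbound c a])
when all its finite submatrices are bounded by [c] on vectors.  The entries of
an operator of norm at most [c] are such a matrix ([mxbound_entry]), every such
matrix comes from an operator ([bop_of_mxbound]), and that operator again has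
norm at most [c] ([mxbound_op_le], for [c = 1]).  Hence [k] has Schur norm at
most [1] iff entrywise multiplication by [k] preserves [mxbound 1]
([schur_contractionP]), which only speaks of finite sums.

If [k] is a real Schur contraction and [s >= 0] then [exp (- s (1 - k))] is a
Schur contraction ([schur_contraction_exp]), being the pointwise limit of
[((1 - s/n) 1 + (s/n) k)^n], a power of a convex combination as soon as
[n >= s].

From (1) to (2): replacing [phi_n] by [psi_n = |phi_n|^2], the product of
[phi_n] and its conjugate, gives multipliers with values in [0, 1].  Enumerate
[G] and pass to a subsequence such that [1 - psi_j <= 2^-j] on the first [j]
elements; then [phi = sum_j (1 - psi_j)] converges pointwise.  The function
[exp (- t phi)] is the limit of the finite products of the
[exp (- t (1 - psi_j))], hence has norm at most [1]
([B2norm_le1_expR_series]).  The function [phi] is proper: if [phi g < n], then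
not all of the first [2n] terms are at least [1/2], so that [g] lies in one of
finitely many of the sets [{psi_j > 1/2}], which are finite.

From (2) to (1): [|exp (- phi)| <= 1] forces [phi >= 0], and then
[phi_n = exp (- phi / (n + 1))] vanishes at infinity because [phi] is proper. *)

Local Notation Re := complex.Re.
Local Notation Im := complex.Im.

(** * Complex numbers: squared modulus and componentwise convergence *)

(** The squared modulus, free of the square root in [cmod], so that [ring] and
[lra] apply to it. *)
Definition nsq (R : realType) (z : R[i]) : R := Re z ^+ 2 + Im z ^+ 2.

Lemma cmodE (R : realType) (z : R[i]) : cmod z ^+ 2 = nsq z.
Proof. by case: z => a b; rewrite /= sqr_sqrtr// addr_ge0 ?sqr_ge0. Qed.

Lemma nsq_ge0 (R : realType) (z : R[i]) : 0 <= nsq z.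
Proof. by rewrite addr_ge0 ?sqr_ge0. Qed.

Lemma nsqM (R : realType) (z w : R[i]) : nsq (z * w) = nsq z * nsq w.
Proof. by case: z w => [a b] [c d]; rewrite /nsq /=; ring. Qed.

Lemma nsqJ (R : realType) (z : R[i]) : nsq z^* = nsq z.
Proof. by case: z => a b; rewrite /nsq /= sqrrN. Qed.

Lemma nsqR (R : realType) (r : R) : nsq r%:C = r ^+ 2.
Proof. by rewrite /nsq /= expr0n addr0. Qed.

Lemma nsq0 (R : realType) : nsq (0 : R[i]) = 0.
Proof. by rewrite nsqR expr0n. Qed.

Lemma mulJ_nsq (R : realType) (z : R[i]) : z * z^* = (nsq z)%:C.
Proof.
case: z => a b; apply/eqP; rewrite eq_complex /nsq /=.
by apply/andP; split; apply/eqP; ring.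
Qed.

(** A weighted parallelogram inequality.  Taking [d] small makes the first
summand essentially undistorted, which replaces the triangle inequality of
[l2norm] in density arguments. *)
Lemma nsqD_le (R : realType) (d : R) (z w : R[i]) : 0 < d ->
  nsq (z + w) <= (1 + d) * nsq z + (1 + d^-1) * nsq w.
Proof.
have D x y : 0 < d -> (x + y) ^+ 2 <= (1 + d) * x ^+ 2 + (1 + d^-1) * y ^+ 2 :> R.
  move=> d0; rewrite -subr_ge0.
  rewrite (_ : _ - _ = d * (x - d^-1 * y) ^+ 2); last by field; rewrite gt_eqF.
  by rewrite mulr_ge0 ?sqr_ge0 ?ltW.
case: z w => [z1 z2] [w1 w2] d0; rewrite /nsq /=.
have := D z1 w1 d0; have := D z2 w2 d0; lra.
Qed.

(** Convergence of the real and imaginary parts: it reduces limits of complex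
sums and products to limits in [R].  It is the usual convergence, see
[cvg_complexP]. *)
Definition ccvg (R : realType) (I : Type) (F : set_system I) (h : I -> R[i]) (l : R[i]) :=
  (Re (h i) @[i --> F] --> Re l) /\ (Im (h i) @[i --> F] --> Im l).

Section ccvg.
Context {R : realType} {I : Type} (F : set_system I) {FF : ProperFilter F}.
Implicit Types (h g : I -> R[i]) (l m : R[i]).

Lemma ccvg_unique h l m : ccvg F h l -> ccvg F h m -> l = m.
Proof.
move=> [h1 h2] [h3 h4]; apply/eqP; rewrite eq_complex; apply/andP.
split; apply/eqP; first exact: (cvg_unique _ h1 h3).
exact: (cvg_unique _ h2 h4).
Qed.

Lemma ccvg_cst l : ccvg F (fun=> l) l.
Proof. by split; exact: cvg_cst. Qed.

Lemma ccvgD h g l m : ccvg F h l -> ccvg F g m -> ccvg F (fun i => h i + g i) (l + m).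
Proof.
have D z w : (Re (z + w) = Re z + Re w :> R) /\ (Im (z + w) = Im z + Im w :> R).
  by case: z w => [a b] [c d].
move=> [h1 h2] [h3 h4]; split.
  by rewrite (D _ _).1; under eq_fun do rewrite (D _ _).1; exact: cvgD.
by rewrite (D _ _).2; under eq_fun do rewrite (D _ _).2; exact: cvgD.
Qed.

Lemma ccvgM h g l m : ccvg F h l -> ccvg F g m -> ccvg F (fun i => h i * g i) (l * m).
Proof.
have D z w : (Re (z * w) = Re z * Re w - Im z * Im w :> R)
   /\ (Im (z * w) = Re z * Im w + Im z * Re w :> R).
  by case: z w => [a b] [c d].
move=> [h1 h2] [h3 h4]; split.
  by rewrite (D _ _).1; under eq_fun do rewrite (D _ _).1; apply: cvgB; exact: cvgM.
by rewrite (D _ _).2; under eq_fun do rewrite (D _ _).2; apply: cvgD; exact: cvgM.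
Qed.

Lemma ccvg_sum (J : Type) (s : seq J) (h : J -> I -> R[i]) (l : J -> R[i]) :
  (forall j, ccvg F (h j) (l j)) ->
  ccvg F (fun i => \sum_(j <- s) h j i) (\sum_(j <- s) l j).
Proof.
move=> hl; elim: s => [|j s IH].
  by rewrite big_nil; under eq_fun do rewrite big_nil; exact: ccvg_cst.
by rewrite big_cons; under eq_fun do rewrite big_cons; apply: ccvgD.
Qed.

Lemma ccvg_nsq h l : ccvg F h l -> nsq (h i) @[i --> F] --> nsq l.
Proof. by move=> [h1 h2]; rewrite /nsq; apply: cvgD; apply: cvgM. Qed.

Lemma sum_nsq_lim_le (J : Type) (s : seq J) (h : J -> I -> R[i]) (l : J -> R[i]) (M : R) :
  (forall j, ccvg F (h j) (l j)) ->
  (forall i, \sum_(j <- s) nsq (h j i) <= M) -> \sum_(j <- s) nsq (l j) <= M.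
Proof.
move=> hl hM.
have : \sum_(j <- s) nsq (h j i) @[i --> F] --> \sum_(j <- s) nsq (l j).
  elim: s {hM} => [|j s IH].
    by rewrite big_nil; under eq_fun do rewrite big_nil; exact: cvg_cst.
  rewrite big_cons; under eq_fun do rewrite big_cons.
  by apply: cvgD => //; exact: ccvg_nsq.
move=> hc; apply: (cvgr_to_le hc); exact: nearW.
Qed.
End ccvg.

Lemma cvg_complexP (R : realType) (I : Type) (F : set_system I) (FF : ProperFilter F)
  (h : I -> R[i]) (l : R[i]) :
  ((h i : R[i]^o) @[i --> F] --> (l : R[i]^o)) <-> ccvg F h l.
Proof.
have normE (z : R[i]) (e : R) : (`|z| < e%:C) = (cmod z < e) by rewrite ltcR.
have nsqB (z w : R[i]) : cmod (z - w) ^+ 2 = (Re z - Re w) ^+ 2 + (Im z - Im w) ^+ 2.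
  by rewrite cmodE; case: z w => [a b] [c d].
split=> [/cvgrPdist_lt hl|[hr hi]].
  have key e : 0 < e -> \forall i \near F,
      (Re l - Re (h i)) ^+ 2 + (Im l - Im (h i)) ^+ 2 < e ^+ 2.
    move=> e0; have /hl : 0 < e%:C by rewrite ltcR.
    by apply: filterS => i; rewrite normE -nsqB ltr_sqr ?nnegrE ?cmod_ge0 ?(ltW e0).
  split; apply/cvgrPdist_lt => e e0; apply: filterS (key e e0) => i hi.
    rewrite -ltr_sqr ?nnegrE ?(ltW e0)// real_normK ?num_real//.
    by apply: le_lt_trans hi; rewrite lerDl sqr_ge0.
  rewrite -ltr_sqr ?nnegrE ?(ltW e0)// real_normK ?num_real//.
  by apply: le_lt_trans hi; rewrite lerDr sqr_ge0.
apply/cvgrPdist_lt => -[e e']; rewrite ltcE /= => /andP[/eqP-> e0].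
have : (Re l - Re (h i)) ^+ 2 + (Im l - Im (h i)) ^+ 2 @[i --> F] --> (0 : R).
  rewrite -[X in _ --> X](addr0 0) -[X in _ --> X + _](expr0n R 2) -[X in _ --> _ + X](expr0n R 2).
  rewrite -{1}(subrr (Re l)) -(subrr (Im l)).
  by apply: cvgD; apply: cvgM; apply: cvgB => //; exact: cvg_cst.
move=> /cvgr_lt/(_ (e ^+ 2)); rewrite exprn_gt0// => /(_ isT).
apply: filterS => i; rewrite -nsqB => hlt.
by rewrite [_ +i* 0]/(e%:C) normE -ltr_sqr ?nnegrE ?cmod_ge0 ?(ltW e0).
Qed.

Lemma ccvg_eventually_cst (R : realType) (I : Type) (F : set_system I) (FF : ProperFilter F)
  (h : I -> R[i]) (l : R[i]) : (\forall i \near F, h i = l) -> ccvg F h l.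
Proof.
move=> hl; split; apply: cvg_near_cst; by apply: filterS hl => i ->.
Qed.

Lemma ccvgR (R : realType) (I : Type) (F : set_system I) (FF : ProperFilter F)
    (u : I -> R) (l : R) :
  u n @[n --> F] --> l -> ccvg F (fun n => (u n)%:C) l%:C.
Proof. by move=> ul; split=> //=; exact: cvg_cst. Qed.

(** Compactness of closed disks, by way of segments. *)
Lemma bounded_ultra_ccvg (R : realType) (I : Type) (F : set_system I) (FF : UltraFilter F)
  (h : I -> R[i]) (M : R) : (forall i, nsq (h i) <= M) -> exists l, ccvg F h l.
Proof.
have key (f : I -> R) (N : R) : (forall i, `|f i| <= N) -> exists l : R, f i @[i --> F] --> l.
  move=> fN.
  have := @segment_compact R (- N) N (f @ F) _ _.
  case.
    by apply: nearW => i; rewrite /= in_itv /= -ler_norml.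
  move=> l [_ hl]; exists l => B Bl.
  have [//|FnB] := in_ultra_setVsetC (f @^-1` B) FF.
  by have [x [/= nB Bx]] := hl (~` B) B FnB Bl.
move=> hM; have hN z : nsq z <= M -> `|Re z| <= Num.sqrt M /\ `|Im z| <= Num.sqrt M.
  move=> zM; rewrite -!sqrtr_sqr; split; apply: ler_wsqrtr; apply: le_trans zM.
    by rewrite lerDl sqr_ge0.
  by rewrite lerDr sqr_ge0.
have [a ha] := key (fun i => Re (h i)) (Num.sqrt M) (fun i => (hN _ (hM i)).1).
have [b hb] := key (fun i => Im (h i)) (Num.sqrt M) (fun i => (hN _ (hM i)).2).
by exists (a +i* b).
Qed.

(** Such an ultrafilter assigns a sum to every family whose finite partial sums
are bounded. *)
Lemma fset_ultrafilter (X : choiceType) : exists F : set_system {fset X},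
  UltraFilter F /\ forall T : {fset X}, F [set S | (T `<=` S)%fset].
Proof.
pose F0 := filter_from [set: {fset X}] (fun T : {fset X} => [set S : {fset X} | (T `<=` S)%fset]).
have F0P : ProperFilter F0.
  apply: filter_from_proper; last by move=> T _; exists T => /=.
  apply: filter_from_filter; first by exists fset0.
  move=> S T _ _; exists (S `|` T)%fset => // U /=.
  by rewrite fsubUset => /andP[].
have [F [FU F0F]] := ultraFilterLemma F0P.
by exists F; split=> // T; apply: F0F; exists T.
Qed.

(** * Square-summable functions and finite truncations *)

Section ell2.
Context {R : realType} {X : choiceType}.
Implicit Types (f g : X -> R[i]^o) (u v : ell2 R X) (A B : bop R X).

Lemma l2sqE f : l2sq f = \esum_(x in [set: X]) (nsq (f x))%:E.
Proof. by apply: eq_esum => x _; rewrite cmodE. Qed.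

Lemma l2sq_leP f (c : R) :
  (l2sq f <= c%:E)%E <-> forall S : {fset X}, \sum_(x <- S) nsq (f x) <= c.
Proof.
rewrite l2sqE; split=> h.
  move=> S; rewrite -lee_fin; apply: le_trans h; apply: esum_ge.
  exists [set` S]; first by split.
  by rewrite fsbig_finite//= set_fsetK sumEFin.
apply: ge_ereal_sup => _ [D [Dfin _] <-].
by rewrite fsbig_finite//= sumEFin lee_fin.
Qed.

Lemma l2sq_sqr u : l2sq u = (l2norm u ^+ 2)%:E.
Proof.
have u0 : (0 <= l2sq u)%E.
  by apply: esum_ge0 => x _; rewrite lee_fin sqr_ge0.
have /square_summableP ufin := ell2P u.
by rewrite /l2norm sqr_sqrtr ?fine_ge0// fineK// ge0_fin_numE.
Qed.

Lemma l2norm_ge0 u : 0 <= l2norm u. Proof. exact: sqrtr_ge0. Qed.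

Lemma l2norm_leP u (c : R) : 0 <= c ->
  l2norm u <= c <-> forall S : {fset X}, \sum_(x <- S) nsq (u x) <= c ^+ 2.
Proof.
move=> c0; rewrite -l2sq_leP l2sq_sqr lee_fin ler_sqr ?nnegrE//.
exact: l2norm_ge0.
Qed.

Lemma sum_nsq_le_l2norm u (S : {fset X}) : \sum_(x <- S) nsq (u x) <= l2norm u ^+ 2.
Proof. by move: S; apply/l2norm_leP => //; exact: l2norm_ge0. Qed.

Lemma ell2_lin a u v (x : X) : (a *: u + v) x = a * u x + v x.
Proof. by []. Qed.
Lemma ell2D u v (x : X) : (u + v) x = u x + v x.
Proof. by []. Qed.
Lemma ell2Z a u (x : X) : (a *: u) x = a * u x.
Proof. by []. Qed.

Lemma l2normZ_le (r : R) u : 0 <= r -> l2norm (r%:C *: u) <= r * l2norm u.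
Proof.
move=> r0; apply/l2norm_leP; first by rewrite mulr_ge0 ?l2norm_ge0.
move=> S; under eq_bigr do rewrite ell2Z nsqM nsqR.
rewrite -mulr_sumr exprMn ler_wpM2l ?sqr_ge0//.
by move: S; apply/l2norm_leP => //; exact: l2norm_ge0.
Qed.

Lemma fset_sum_if_le (g : X -> R) (S T : {fset X}) : (forall x, 0 <= g x) ->
  \sum_(x <- S) (if x \in T then g x else 0) <= \sum_(x <- T) g x.
Proof.
move=> g0; rewrite -big_mkcond [leRHS](bigID (fun x => x \in S))/=.
rewrite -[leLHS]addr0 lerD ?sumr_ge0//.
rewrite le_eqVlt; apply/orP; left; apply/eqP.
rewrite -big_filter -[RHS]big_filter; apply/perm_big/uniq_perm.
- by rewrite filter_uniq// fset_uniq.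
- by rewrite filter_uniq// fset_uniq.
- by move=> x; rewrite !mem_filter andbC.
Qed.

Lemma l2sq_restrict_le f (T : {fset X}) :
  (l2sq (fun x => if x \in T then f x else 0%R) <= (\sum_(x <- T) nsq (f x))%:E)%E.
Proof.
apply/l2sq_leP => S.
rewrite (eq_bigr (fun x => if x \in T then nsq (f x) else 0)).
  by apply: fset_sum_if_le => x; exact: nsq_ge0.
by move=> x _; case: ifP => // _; rewrite nsq0.
Qed.

Lemma restrict_subproof f (T : {fset X}) :
  (fun x => if x \in T then f x else 0) \in @square_summable R X.
Proof. apply/square_summableP; exact: le_lt_trans (l2sq_restrict_le f T) (ltry _). Qed.

Definition restrict f T : ell2 R X := Ell2 (restrict_subproof f T).

Lemma l2norm_restrict f T : l2norm (restrict f T) ^+ 2 <= \sum_(x <- T) nsq (f x).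
Proof. by rewrite -lee_fin -l2sq_sqr; exact: l2sq_restrict_le. Qed.

Lemma ell2_sum (J : Type) (s : seq J) (v : J -> ell2 R X) (x : X) :
  (\sum_(j <- s) v j) x = \sum_(j <- s) v j x.
Proof. by elim: s => [|j s IH]; rewrite ?big_nil ?big_cons// ell2D IH. Qed.

Lemma restrictE f T : restrict f T = \sum_(y <- T) f y *: delta y.
Proof.
apply/val_inj/funext => x; rewrite [RHS]ell2_sum.
under [RHS]eq_bigr do rewrite ell2Z.
rewrite /=.
case: ifPn => [xT|xT].
  rewrite (big_fsetD1 x)//= eqxx mulr1 big_seq big1 ?addr0// => y.
  by rewrite !inE eq_sym => /andP[/negbTE-> _]; rewrite mulr0.
rewrite big_seq big1// => y yT; case: eqVneq => [xy|_]; last by rewrite mulr0.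
by rewrite xy yT in xT.
Qed.

Lemma bop_restrict A f T x : A (restrict f T) x = \sum_(y <- T) entry A x y * f y.
Proof.
rewrite restrictE linear_sum ell2_sum; apply: eq_bigr => y _.
by rewrite linearZ ell2Z mulrC.
Qed.

(** * Bounded operators and matrices with bounded finite sections *)

(** The operator norm of every finite submatrix of [a] is at most [c].  The
formulation by squared norms of vectors makes this condition stable under
pointwise limits of [a]. *)
Definition mxbound (c : R) (a : X -> X -> R[i]) := forall (S T : {fset X}) (f : X -> R[i]),
  \sum_(x <- S) nsq (\sum_(y <- T) a x y * f y) <= c ^+ 2 * \sum_(y <- T) nsq (f y).

Lemma mxbound_entry A (c : R) : 0 <= c -> (forall u, l2norm (A u) <= c * l2norm u) ->
  mxbound c (entry A).
Proof.
move=> c0 hA S T f; under eq_bigr do rewrite -bop_restrict.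
apply: (@le_trans _ _ (l2norm (A (restrict f T)) ^+ 2)).
  exact: sum_nsq_le_l2norm.
apply: (@le_trans _ _ ((c * l2norm (restrict f T)) ^+ 2)).
  by rewrite ler_sqr ?nnegrE ?mulr_ge0 ?l2norm_ge0.
by rewrite exprMn ler_wpM2l ?sqr_ge0// l2norm_restrict.
Qed.

(** Finitely supported functions are dense: [l2sq] is additive over a function
and its truncation, and the truncation carries all but [e] of the sum. *)
Lemma restrict_approx u (e : R) : 0 < e -> exists T, l2norm (u - restrict u T) ^+ 2 <= e.
Proof.
move=> e0.
have [T hT] : exists T : {fset X}, l2norm u ^+ 2 - e <= \sum_(x <- T) nsq (u x).
  apply/not_existsP => h.
  have : (l2sq u <= (l2norm u ^+ 2 - e)%:E)%E.
    by apply/l2sq_leP => S; apply: ltW; rewrite ltNge; apply/negP; exact: h.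
  by rewrite l2sq_sqr lee_fin; lra.
exists T; have split_u : l2sq u = (l2sq (restrict u T) + l2sq (u - restrict u T)%R)%E.
  rewrite !l2sqE -esumD => [|x _|x _]; rewrite ?lee_fin ?nsq_ge0//.
  apply: eq_esum => x _; rewrite -EFinD; congr EFin.
  rewrite -scaleN1r ell2D ell2Z mulN1r /=.
  by case: ifP => _; rewrite ?subrr ?subr0 nsq0 ?addr0 ?add0r.
have le_r : \sum_(x <- T) nsq (u x) <= l2norm (restrict u T) ^+ 2.
  apply: le_trans (sum_nsq_le_l2norm _ T).
  rewrite big_seq [leRHS]big_seq; apply: ler_sum => x xT.
  by rewrite /= xT.
move/eqP: split_u; rewrite !l2sq_sqr -EFinD eqe => /eqP; lra.
Qed.

(** By hypothesis the bound holds on finitely supported vectors.  It extends by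
density, as [A] is bounded by some constant [c]. *)
Lemma mxbound_op_le A : mxbound 1 (entry A) -> forall u, l2norm (A u) <= l2norm u.
Proof.
move=> hA u; apply/l2norm_leP; first exact: l2norm_ge0.
move=> S; have [c hc] := bop_bounded A.
set M := l2norm u ^+ 2.
suff key d : 0 < d -> d <= 1 -> \sum_(x <- S) nsq (A u x) <= M + d * (M + 2 * c ^+ 2).
  apply/ler_addgt0Pr => e e0.
  set K := M + 2 * c ^+ 2 in key.
  have K0 : 0 <= K by have := sqr_ge0 c; have := sqr_ge0 (l2norm u); rewrite /K /M; lra.
  (* This gives [d * K <= e]; the [+ 1] covers the case [K = 0]. *)
  pose d := Num.min 1 (e / (K + 1)).
  have d0 : 0 < d by rewrite lt_min ltr01 divr_gt0// ltr_wpDl.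
  apply: (le_trans (key d d0 _)); first by rewrite ge_min lexx.
  rewrite lerD2l; apply: (@le_trans _ _ (e / (K + 1) * K)).
    by rewrite ler_wpM2r// ge_min lexx orbT.
  by rewrite mulrAC ler_pdivrMr ?ltr_wpDl// ler_wpM2l ?ltW//; lra.
move=> d0 d1.
(* The error is weighted by [1 + d^-1] below, whence the accuracy [d ^+ 2]. *)
have [T hT] := @restrict_approx u (d ^+ 2) (exprn_gt0 _ d0).
set w := u - restrict u T in hT.
have -> : u = restrict u T + w by rewrite /w addrC subrK.
rewrite linearD.
apply: (@le_trans _ _ (\sum_(x <- S) ((1 + d) * nsq (A (restrict u T) x) + (1 + d^-1) * nsq (A w x)))).
  by apply: ler_sum => x _; exact: nsqD_le.
rewrite big_split /= -!mulr_sumr.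
have h1 : \sum_(x <- S) nsq (A (restrict u T) x) <= M.
  under eq_bigr do rewrite bop_restrict.
  apply: le_trans (hA _ _ _) _; rewrite expr1n mul1r.
  exact: sum_nsq_le_l2norm.
have h2 : \sum_(x <- S) nsq (A w x) <= c ^+ 2 * d ^+ 2.
  apply: (@le_trans _ _ (l2norm (A w) ^+ 2)).
    exact: sum_nsq_le_l2norm.
  apply: (@le_trans _ _ ((c * l2norm w) ^+ 2)).
    rewrite ler_sqr ?nnegrE ?l2norm_ge0//.
    exact: le_trans (l2norm_ge0 _) (hc w).
  by rewrite exprMn ler_wpM2l ?sqr_ge0.
have h3 : (1 + d) * (\sum_(x <- S) nsq (A (restrict u T) x)) <= (1 + d) * M.
  by rewrite ler_wpM2l// addr_ge0// ltW.
have h4 : (1 + d^-1) * (\sum_(x <- S) nsq (A w x)) <= (1 + d^-1) * (c ^+ 2 * d ^+ 2).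
  by rewrite ler_wpM2l// addr_ge0// invr_ge0 ltW.
have h5 : (1 + d^-1) * (c ^+ 2 * d ^+ 2) = (d + 1) * d * c ^+ 2.
  by field; rewrite gt_eqF.
have h6 : (d + 1) * d * c ^+ 2 <= 2 * d * c ^+ 2.
  by rewrite ler_wpM2r ?sqr_ge0// ler_wpM2r ?(ltW d0)// -lerBrDr; lra.
lra.
Qed.

(** The coordinate [x] of the operator at [u] is the limit of the finite sums
[h u x T] of [a x y * u y] over [y] in [T], along an ultrafilter on the finite
sets [T].  These sums are bounded, so the limit exists without any summability
argument, and linearity and the norm bound pass to the limit. *)
Lemma bop_of_mxbound (a : X -> X -> R[i]) (c : R) : 0 <= c -> mxbound c a ->
  exists B : bop R X, forall x y, entry B x y = a x y.
Proof.
move=> c0 ha; have [F [FU FT]] := fset_ultrafilter X.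
pose h u x (T : {fset X}) := \sum_(y <- T) a x y * u y.
have hS u (S T : {fset X}) : \sum_(x <- S) nsq (h u x T) <= (c * l2norm u) ^+ 2.
  apply: le_trans (ha S T u) _; rewrite exprMn ler_wpM2l ?sqr_ge0//.
  exact: sum_nsq_le_l2norm.
have hcv u x : exists l, ccvg F (h u x) l.
  apply: (@bounded_ultra_ccvg _ _ _ _ _ ((c * l2norm u) ^+ 2)) => T.
  by have := hS u [fset x]%fset T; rewrite big_seq_fset1.
pose b u x : R[i]^o := projT1 (cid (hcv u x)).
have bP u x : ccvg F (h u x) (b u x) by exact: projT2 (cid (hcv u x)).
have bS u (S : {fset X}) : \sum_(x <- S) nsq (b u x) <= (c * l2norm u) ^+ 2.
  by apply: (@sum_nsq_lim_le _ _ F _ _ _ (h u) _ _ (bP u)) => T; exact: hS.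
have b_ss u : b u \in square_summable.
  apply/square_summableP; apply: (@le_lt_trans _ _ ((c * l2norm u) ^+ 2)%:E); last exact: ltry.
  exact/l2sq_leP.
pose Bf u : ell2 R X := Ell2 (b_ss u).
have Blin : linear Bf.
  move=> r u v; apply/val_inj/funext => x.
  change (b (r *: u + v) x = r * b u x + b v x).
  apply: (ccvg_unique (bP (r *: u + v) x)).
  have -> : h (r *: u + v) x = (fun T => r * h u x T + h v x T).
    apply/funext => T; rewrite /h mulr_sumr -big_split; apply: eq_bigr => y _.
    by rewrite ell2_lin mulrDr mulrCA.
  by apply: ccvgD (bP v x); apply: ccvgM (bP u x); exact: ccvg_cst.
pose BL : {linear ell2 R X -> ell2 R X} := 
  HB.pack Bf (GRing.isLinear.Build _ _ _ _ Bf Blin).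
have Bbd : exists c : R, forall u, l2norm (BL u) <= c * l2norm u.
  exists c => u; apply/l2norm_leP; first by rewrite mulr_ge0// l2norm_ge0.
  exact: bS.
exists (Bop Bbd) => x y; rewrite /entry /=.
apply: (ccvg_unique (bP (delta y) x)).
apply: ccvg_eventually_cst; apply: filterS (FT [fset y]%fset) => T /=.
rewrite fsub1set => yT; rewrite /h (big_fsetD1 y)//= eqxx mulr1.
rewrite big_seq big1 ?addr0// => z.
by rewrite !inE => /andP[/negbTE-> _]; rewrite mulr0.
Qed.

Lemma opnorm_le A (c : R) : 0 <= c -> (forall u, l2norm (A u) <= c * l2norm u) -> opnorm A <= c.
Proof.
move=> c0 hA; apply: ge_sup.
  exists (l2norm (A 0)), 0 => //=; apply/l2norm_leP => // S.
  by rewrite big1 ?expr1n// => x _; rewrite nsq0.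
move=> _ [u /= u1 <-]; apply: le_trans (hA u) _.
by rewrite -[leRHS]mulr1 ler_wpM2l.
Qed.

Lemma le_opnorm A u : l2norm (A u) <= opnorm A * l2norm u.
Proof.
have [c hc] := bop_bounded A.
have ub v : l2norm v <= 1 -> l2norm (A v) <= opnorm A.
  move=> v1; apply: ub_le_sup; last by exists v.
  exists `|c| => _ [w /= w1 <-].
  apply: le_trans (hc w) _; apply: (@le_trans _ _ (`|c| * l2norm w)).
    by rewrite ler_wpM2r ?l2norm_ge0// ler_norm.
  by rewrite -[leRHS]mulr1 ler_wpM2l.
have [u0|u0] := eqVneq (l2norm u) 0.
  by have := hc u; rewrite u0 !mulr0.
have ugt0 : 0 < l2norm u by rewrite lt_def u0 l2norm_ge0.
(* Normalize [u] and scale back. *)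
set r := l2norm u in ugt0 *.
have r0 : r != 0 by rewrite gt_eqF.
have -> : A u = r%:C *: A (r^-1%:C *: u).
  by rewrite linearZ scalerA -rmorphM/= divff// scale1r.
apply: le_trans (l2normZ_le _ (ltW ugt0)) _; rewrite mulrC ler_wpM2r ?(ltW ugt0)//.
by apply: ub; apply: le_trans (l2normZ_le _ _) _; rewrite ?invr_ge0 ?(ltW ugt0)// mulVf.
Qed.

Lemma mxbound_scale (c d : R) (a : X -> X -> R[i]) : mxbound d a ->
  mxbound (c * d) (fun x y => c%:C * a x y).
Proof.
move=> ha S T f.
have -> : \sum_(x <- S) nsq (\sum_(y <- T) c%:C * a x y * f y) =
    c ^+ 2 * \sum_(x <- S) nsq (\sum_(y <- T) a x y * f y).
  rewrite mulr_sumr; apply: eq_bigr => x _.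
  by rewrite -nsqR -nsqM mulr_sumr; congr nsq; apply: eq_bigr => y _; rewrite mulrA.
by apply: le_trans (ler_wpM2l (sqr_ge0 c) (ha S T f)) _; rewrite mulrA exprMn.
Qed.

Lemma eq_mxbound (c : R) (a b : X -> X -> R[i]) : (forall x y, a x y = b x y) -> mxbound c a -> mxbound c b.
Proof. by move=> ab; rewrite (_ : a = b)//; apply/funext => x; apply/funext => y. Qed.

(** * Schur contractions *)

(** Equivalent to having Schur norm at most [1], by [schur_contractionP]. *)
Definition schur_contraction (k : X -> X -> R[i]) := forall a : X -> X -> R[i],
  mxbound 1 a -> mxbound 1 (fun x y => k x y * a x y).

(** From left to right, a matrix bounded by [1] is realized as an operator, to
which the Schur norm applies.  From right to left, [mxbound_op_le] bounds the
operator chosen by [schur_op], of which only the entries are known. *)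
Lemma schur_contractionP (k : X -> X -> R[i]) :
  (exists h : schur_multiplier k, (schur_norm h <= 1%:E)%E) <-> schur_contraction k.
Proof.
split=> [[h hn] a ha|hk].
  have [A hA] := bop_of_mxbound ler01 ha.
  have A1 u : l2norm (A u) <= l2norm u.
    by apply: mxbound_op_le; exact: eq_mxbound ha.
  have opA : opnorm A <= 1 by apply: opnorm_le => // u; rewrite mul1r.
  have opB : opnorm (schur_op h A) <= 1.
    by rewrite -lee_fin; apply: le_trans hn; apply: ereal_sup_ubound; exists A.
  have B1 u : l2norm (schur_op h A u) <= 1 * l2norm u.
    by apply: le_trans (le_opnorm _ u) _; rewrite ler_wpM2r ?l2norm_ge0.
  apply: eq_mxbound (mxbound_entry ler01 B1) => x y.
  by rewrite (projT2 (cid (h A))) hA.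
have bound A c : 0 < c -> (forall u, l2norm (A u) <= c * l2norm u) ->
    mxbound c (fun x y => k x y * entry A x y).
  move=> c0 hA.
  have := @mxbound_scale c^-1 _ _ (mxbound_entry (ltW c0) hA).
  rewrite mulVf ?gt_eqF// => /hk h1.
  have := @mxbound_scale c _ _ h1; rewrite mulr1.
  apply: eq_mxbound => x y; rewrite mulrCA [c%:C * _]mulrA.
  by rewrite -rmorphM/= divff ?gt_eqF// mul1r.
have h : schur_multiplier k.
  move=> A; have [c hc] := bop_bounded A.
  have c0 : 0 < `|c| + 1 by rewrite ltr_wpDl.
  apply: (@bop_of_mxbound _ (`|c| + 1)); first exact: ltW.
  apply: bound => // u; apply: le_trans (hc u) _.
  by rewrite ler_wpM2r ?l2norm_ge0// (le_trans (ler_norm c))// lerDl.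
exists h; apply: ge_ereal_sup => _ [A /= A1 <-]; rewrite lee_fin.
apply: opnorm_le => // u; rewrite mul1r; apply: mxbound_op_le.
apply: (@eq_mxbound _ (fun x y => k x y * entry A x y)).
  by move=> x y; rewrite (projT2 (cid (h A))).
apply: bound => // v; apply: le_trans (le_opnorm A v) _.
by rewrite ler_wpM2r ?l2norm_ge0.
Qed.

Lemma schur_contraction1 : schur_contraction (fun _ _ => 1).
Proof. by move=> a; apply: eq_mxbound => x y; rewrite mul1r. Qed.

Lemma schur_contractionM k1 k2 : schur_contraction k1 -> schur_contraction k2 ->
  schur_contraction (fun x y => k1 x y * k2 x y).
Proof. by move=> h1 h2 a /h2/h1; apply: eq_mxbound => x y; rewrite mulrA. Qed.

Lemma mxboundJ (c : R) (a : X -> X -> R[i]) : mxbound c a -> mxbound c (fun x y => conjc (a x y)).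
Proof.
move=> ha S T f.
have -> : \sum_(y <- T) nsq (f y) = \sum_(y <- T) nsq (conjc (f y)).
  by apply: eq_bigr => y _; rewrite nsqJ.
apply: le_trans (ha S T _); apply: ler_sum => x _.
rewrite -nsqJ rmorph_sum le_eqVlt; apply/orP; left; apply/eqP; congr nsq.
by apply: eq_bigr => y _; rewrite rmorphM/= conjcK.
Qed.

Lemma schur_contractionJ k : schur_contraction k ->
  schur_contraction (fun x y => conjc (k x y)).
Proof.
move=> hk a /mxboundJ/hk/mxboundJ; apply: eq_mxbound => x y.
by rewrite rmorphM/= conjcK.
Qed.

(** Convexity of the squared modulus, applied to each coordinate of the image. *)
Lemma schur_contraction_convex (p : R) k1 k2 : 0 <= p <= 1 ->
  schur_contraction k1 -> schur_contraction k2 ->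
  schur_contraction (fun x y => p%:C * k1 x y + (1 - p)%:C * k2 x y).
Proof.
move=> /andP[p0 p1] h1 h2 a ha S T f.
have := h1 a ha S T f; have := h2 a ha S T f.
rewrite expr1n mul1r; set M := \sum_(y <- T) _.
set s1 := \sum_(x <- S) _; set s2 := \sum_(x <- S) _; move=> le1 le2.
apply: (@le_trans _ _ (p * s2 + (1 - p) * s1)).
  rewrite /s1 /s2 !mulr_sumr -big_split; apply: ler_sum => x _.
  have cvx z w : nsq (p%:C * z + (1 - p)%:C * w) <= p * nsq z + (1 - p) * nsq w.
    case: z w => [a1 b1] [a2 b2]; rewrite /nsq /= -subr_ge0.
    rewrite (_ : _ - _ = p * (1 - p) * ((a1 - a2) ^+ 2 + (b1 - b2) ^+ 2)); last by ring.
    by apply: mulr_ge0; [apply: mulr_ge0 => //; rewrite subr_ge0|rewrite addr_ge0 ?sqr_ge0].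
  apply: le_trans (cvx _ _); rewrite !mulr_sumr -big_split le_eqVlt.
  apply/orP; left; apply/eqP; congr nsq; apply: eq_bigr => y _ /=; ring.
have : p * s2 <= p * M by rewrite ler_wpM2l.
have : (1 - p) * s1 <= (1 - p) * M by rewrite ler_wpM2l// subr_ge0.
lra.
Qed.

Lemma schur_contraction_lim (k : nat -> X -> X -> R[i]) l :
  (forall x y, ccvg \oo (fun n => k n x y) (l x y)) ->
  (forall n, schur_contraction (k n)) -> schur_contraction l.
Proof.
move=> hl hk a ha S T f.
apply: (@sum_nsq_lim_le _ _ \oo _ _ _ (fun x n => \sum_(y <- T) k n x y * a x y * f y)).
  move=> x; apply: ccvg_sum => y.
  by apply: ccvgM (ccvg_cst _); apply: ccvgM (ccvg_cst _).
by move=> n; exact: hk.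
Qed.

(** Test on the matrix unit with its single entry at [(x, y)]. *)
Lemma schur_contraction_le1 k x y : schur_contraction k -> nsq (k x y) <= 1.
Proof.
move=> hk; have : mxbound 1 (fun x' y' : X => (((x' == x) && (y' == y))%:R : R[i])).
  move=> S T f; rewrite expr1n mul1r.
  set w := \sum_(y' <- T) (y' == y)%:R * f y'.
  have -> : \sum_(x' <- S) nsq (\sum_(y' <- T) ((x' == x) && (y' == y))%:R * f y') =
      \sum_(x' <- S) (if x' \in [fset x]%fset then nsq w else 0).
    apply: eq_bigr => x' _; rewrite inE; case: eqVneq => _ //=.
    by rewrite big1 ?nsq0// => y' _; rewrite mul0r.
  apply: (@le_trans _ _ (nsq w)).
    have := @fset_sum_if_le (fun=> nsq w) S [fset x]%fset (fun=> nsq_ge0 w).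
    by rewrite big_seq_fset1.
  have [yT|yT] := boolP (y \in T).
    rewrite /w !(big_fsetD1 y yT)/= eqxx mul1r [\sum_(i <- _) _ * _]big_seq big1 ?addr0.
      by rewrite lerDl sumr_ge0// => z _; exact: nsq_ge0.
    by move=> z; rewrite !inE => /andP[/negbTE-> _]; rewrite mul0r.
  rewrite /w big_seq big1 ?nsq0 ?sumr_ge0// => z; first by move=> _; exact: nsq_ge0.
  by move=> zT; case: eqVneq zT => [->|_ _]; [rewrite (negbTE yT)|rewrite mul0r].
move=> /hk/(_ [fset x]%fset [fset y]%fset (fun=> 1)); rewrite !big_seq_fset1 !eqxx !mulr1.
by rewrite nsqR !expr1n mulr1.
Qed.
End ell2.

(** * Exponentials of Schur contractions *)

Section exponential.
Context {R : realType}.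

(** With [z = y / n], the inequality [1 + w <= expR w] at [w = - z] gives the
upper bound [expR (- y)], and at [w = z / (1 - z)], where [1 + w] is the inverse
of [1 - z], the lower bound [expR (- y / (1 - z))]. *)
Lemma cvg_expR_compound (y : R) : 0 <= y ->
  (1 - y / n.+1%:R) ^+ n.+1 @[n --> \oo] --> expR (- y).
Proof.
move=> y0.
have cvg_z : y / n.+1%:R @[n --> \oo] --> (0 : R).
  by rewrite -[0 in X in _ --> X](mulr0 y); apply: cvgMr; exact: cvg_harmonic.
have z_lt1 : \forall n \near \oo, y / n.+1%:R < 1.
  by apply: (cvgr_lt _ cvg_z); exact: ltr01.
apply: (@squeeze_cvgr _ _ _ _ (fun n => expR (- y / (1 - y / n.+1%:R))) (fun=> expR (- y))).
- apply: filterS z_lt1 => n z1; set z := y / n.+1%:R in z1 *.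
  have yE : y = n.+1%:R * z by rewrite /z mulrC divfK// pnatr_eq0.
  have z1' : 0 < 1 - z by rewrite subr_gt0.
  rewrite yE -mulrN -mulrA !expRM_natl; apply/andP; split.
    rewrite ler_pXn2r// ?nnegrE ?expR_ge0 ?(ltW z1')//.
    rewrite mulNr expRN -[leRHS]invrK lef_pV2 ?posrE ?invr_gt0 ?expR_gt0//.
    apply: le_trans (expR_ge1Dx _).
    by rewrite le_eqVlt; apply/orP; left; apply/eqP; field; rewrite gt_eqF.
  rewrite ler_pXn2r// ?nnegrE ?expR_ge0 ?(ltW z1')//.
  exact: expR_ge1Dx.
- apply: continuous_cvg; first exact: continuous_expR.
  rewrite -[X in _ --> X](mulr1 (- y)); apply: cvgMr.
  rewrite -[X in _ --> X]invr1; apply: cvgV; first exact: oner_neq0.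
  by rewrite -[X in _ --> X](subr0 1); apply: cvgB => //; exact: cvg_cst.
- exact: cvg_cst.
Qed.

Context {X : choiceType}.
Implicit Types k : X -> X -> R.

Lemma schur_contractionX (k : X -> X -> R[i]) n : schur_contraction k ->
  schur_contraction (fun x y => k x y ^+ n).
Proof.
move=> hk; elim: n => [|n IH]; first exact: schur_contraction1.
rewrite (_ : (fun _ _ => _) = fun x y => k x y * k x y ^+ n); first exact: schur_contractionM.
by apply/funext => x; apply/funext => y; rewrite exprS.
Qed.

(** The limit of the powers [(p + (1 - p) k)^n] with [p = 1 - s / n].  The shift by
[m > s] makes [p] a convex weight from the first term on. *)
Lemma schur_contraction_exp k (s : R) : 0 <= s ->
  schur_contraction (fun x y => (k x y)%:C) ->
  schur_contraction (fun x y => (expR (- (s * (1 - k x y))))%:C).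
Proof.
move=> s0 hk; pose m := Num.bound s.
have s_lt n : s < (n + m).+1%:R.
  apply: lt_le_trans (archi_boundP s0) _; rewrite ler_nat.
  by rewrite -/m -addnS (leq_trans (leqnSn m))// leq_addl.
pose p n := 1 - s / (n + m).+1%:R.
have p01 n : 0 <= p n <= 1.
  have N0 : 0 < (n + m).+1%:R :> R by rewrite ltr0n.
  rewrite /p subr_ge0 ler_pdivrMr// mul1r (ltW (s_lt n))/=.
  by rewrite gerBl divr_ge0// ltW.
apply: (@schur_contraction_lim _ _ (fun n x y =>
   ((p n)%:C * 1 + (1 - p n)%:C * (k x y)%:C) ^+ (n + m).+1)); last first.
  move=> n; apply: schur_contractionX; apply: schur_contraction_convex => //.
  exact: schur_contraction1.
move=> x y; set t := s * (1 - k x y).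
have -> : (fun n => ((p n)%:C * 1 + (1 - p n)%:C * (k x y)%:C) ^+ (n + m).+1) =
  (fun n => ((1 - t / (n + m).+1%:R) ^+ (n + m).+1)%:C).
  apply/funext => n; rewrite rmorphXn/= mulr1 -rmorphM -rmorphD/=.
  by congr ((_)%:C ^+ _); rewrite /p /t; ring.
apply: ccvgR; have /cvg_expR_compound : 0 <= t; last first.
  by move=> h; rewrite -(cvg_shiftn m) in h.
  rewrite mulr_ge0// subr_ge0; have := schur_contraction_le1 x y hk.
  rewrite nsqR => k1; rewrite leNgt; apply/negP => k_gt1; nra.
Qed.
End exponential.

(** * Herz-Schur multipliers *)

Section HerzSchur.
Context {R : realType} {G : groupType}.

Lemma B2norm_le1P (phi : G -> R[i]) : B2norm_le phi 1 <-> schur_contraction (hat_kernel phi).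
Proof. exact: schur_contractionP. Qed.

Lemma B2norm_le1_nsq (phi : G -> R[i]) g : B2norm_le phi 1 -> nsq (phi g) <= 1.
Proof.
by move=> /B2norm_le1P/(schur_contraction_le1 g 1%g); rewrite /hat_kernel invg1 mul1g.
Qed.

(** The exponential of a partial sum is a product of the contractions given by
[schur_contraction_exp]. *)
Lemma B2norm_le1_expR_series (D : nat -> G -> R) (t : R) : 0 < t ->
  (forall j, B2norm_le (fun g => (1 - D j g)%:C) 1) ->
  (forall g, cvgn (series (D^~ g))) ->
  B2norm_le (fun g => (expR (- t * limn (series (D^~ g))))%:C) 1.
Proof.
move=> t0 hD Dcvg; apply/B2norm_le1P.
pose k N (x y : G) := (expR (- t * series (D^~ (y^-1 * x)%g) N))%:C.
apply: (@schur_contraction_lim _ _ k) => [x y|].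
  apply: ccvgR; apply: continuous_cvg; first exact: continuous_expR.
  by apply: cvgMr; exact: Dcvg.
elim=> [|N IH].
  rewrite (_ : k 0%N = fun _ _ => 1); first exact: schur_contraction1.
  apply/funext => x; apply/funext => y.
  by rewrite /k /series/= big_geq// mulr0 expR0.
have /B2norm_le1P/(schur_contraction_exp (ltW t0)) hN := hD N.
rewrite (_ : k N.+1 = fun x y => k N x y * (expR (- (t * (1 - (1 - D N (y^-1 * x)%g)))))%:C).
  exact: schur_contractionM IH hN.
apply/funext => x; apply/funext => y; rewrite /k /= -rmorphM/= -expRD seriesEnat/= big_nat_recr//=.
by congr (expR _)%:C; ring.
Qed.

End HerzSchur.

Theorem theorem1p2 (R : realType) (G : groupType) (G_countable : countable [set: G]) :
  (exists phi : nat -> G -> R[i],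
     [/\ forall n, vanishing_at_infinity (phi n),
         forall g, (phi n g : R[i]^o) @[n --> \oo] --> (1 : R[i]^o)
       & forall n, B2norm_le (phi n) 1])
  <->
  (exists phi : G -> R,
     proper_fun phi /\
     forall t : R, 0 < t -> B2norm_le (fun g => (expR (- t * phi g))%:C) 1).
Proof.
split=> [[phi [phi_van phi_cvg phi_le1]]|[phi [phi_proper phi_le1]]]; last first.
  have phi_ge0 g : 0 <= phi g.
    have := B2norm_le1_nsq g (phi_le1 1 ltr01).
    rewrite nsqR mulN1r -expRM_natl -[leRHS]expR0 ler_expR; lra.
  exists (fun n g => (expR (- n.+1%:R^-1 * phi g))%:C); split.
  - move=> n e e0; apply: sub_finite_set (phi_proper (Num.bound (- (ln e * n.+1%:R)))) => g /=.
    rewrite expr0n addr0 sqrtr_sqr ger0_norm ?expR_ge0// => le_e.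
    have le_phi : phi g <= - (ln e * n.+1%:R).
      have : ln e <= - n.+1%:R^-1 * phi g by rewrite -ler_expR lnK.
      by rewrite mulNr lerNr -mulNr ler_pdivrMl ?ltr0n// mulrC.
    rewrite ger0_norm//; apply: (le_lt_trans le_phi).
    by apply: archi_boundP; exact: le_trans le_phi.
  - move=> g; apply/cvg_complexP; apply: ccvgR; rewrite -[X in _ --> X]expR0.
    apply: continuous_cvg; first exact: continuous_expR.
    rewrite -[X in _ --> X](mul0r (phi g)); apply: cvgMl.
    rewrite -[X in _ --> X]oppr0; apply: cvgN; exact: cvg_harmonic.
  - by move=> n; apply: phi_le1; rewrite invr_gt0 ltr0n.
have psi_le1 n g : nsq (phi n g) <= 1 by exact: B2norm_le1_nsq.
have psi_B2 n : B2norm_le (fun g => (nsq (phi n g))%:C) 1.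
  apply/B2norm_le1P; have /B2norm_le1P h := phi_le1 n.
  rewrite (_ : hat_kernel _ = fun x y => hat_kernel (phi n) x y * conjc (hat_kernel (phi n) x y)).
    by apply: schur_contractionM => //; exact: schur_contractionJ.
  by apply/funext => x; apply/funext => y; rewrite mulJ_nsq.
have psi_cvg g : nsq (phi n g) @[n --> \oo] --> (1 : R).
  have := phi_cvg g => /cvg_complexP/ccvg_nsq.
  by rewrite nsqR expr1n.
have /countable_injP[f f_inj] := G_countable.
have unif j : exists n, forall g, (f g < j)%N -> 1 - nsq (phi n g) <= 2^-1 ^+ j.
  have e0 : (0 : R) < 2^-1 ^+ j by rewrite exprn_gt0.
  have near_g g : \forall n \near \oo, 1 - nsq (phi n g) <= 2^-1 ^+ j.
    have := cvgr_gt _ (psi_cvg g) (1 - 2^-1 ^+ j) _.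
    rewrite ltrBlDr ltrDl => /(_ _ e0).
    by apply: filterS => n; lra.
  suff near_all m : \forall n \near \oo, forall g, (f g < m)%N -> 1 - nsq (phi n g) <= 2^-1 ^+ j.
    by have [N _ hN] := near_all j; exists N; exact: hN N (leqnn N).
  (* Only finitely many [g] satisfy [f g < m]: [f] is injective. *)
  elim: m => [|m IH]; first exact: nearW.
  have [[g0 fg0]|no_g] := pselect (exists g, f g = m).
    apply: filterS2 IH (near_g g0) => n hn hg0 g.
    rewrite ltnS leq_eqVlt => /orP[/eqP fg|]; last exact: hn.
    suff -> : g = g0 by [].
    by apply: f_inj; rewrite ?in_setE// fg fg0.
  apply: filterS IH => n hn g; rewrite ltnS leq_eqVlt => /orP[/eqP fg|]; last exact: hn.
  by case: no_g; exists g.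
have [sigma sigmaP] := choice unif.
pose D j g := 1 - nsq (phi (sigma j) g).
have D_ge0 j g : 0 <= D j g by rewrite subr_ge0.
have D_cvg g : cvgn (series (D^~ g)).
  (* The factor [2 ^+ f g] also covers the first terms, where only [D j g <= 1] is
     known. *)
  apply: (@series_le_cvg _ _ (geometric (2 ^+ f g) 2^-1)) => // [j|j|].
  - by rewrite /= mulr_ge0 ?exprn_ge0.
  - rewrite /=; have [fg_lt|j_le] := ltnP (f g) j.
      apply: le_trans (sigmaP j g fg_lt) _.
      by rewrite ler_peMl ?exprn_ge0// exprn_ege1// ler1n.
    apply: (@le_trans _ _ 1); first by rewrite gerBl nsq_ge0.
    by rewrite exprVn ler_pdivlMr ?exprn_gt0// mul1r ler_weXn2l// ler1n.
  - by apply: is_cvg_geometric_series; rewrite ger0_norm// invf_lt1// ltr1n.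
exists (fun g => limn (series (D^~ g))); split; last first.
  move=> t t0; apply: B2norm_le1_expR_series => // j.
  rewrite (_ : (fun g => _) = fun g => (nsq (phi (sigma j) g))%:C)//.
  by apply/funext => g; rewrite /D subKr.
move=> n.
apply: (@sub_finite_set _ _ (\bigcup_(j in `I_(2 * n)) [set g | 2^-1 <= cmod (phi (sigma j) g)])); last first.
  apply: bigcup_finite => // j _; apply: phi_van; by rewrite invr_gt0.
move=> g /= lt_n; apply: contrapT => h.
(* Outside these sets each of the first [2 * n] terms exceeds [1 - (1/2)^2],
   hence [1/2]. *)
have : n%:R <= limn (series (D^~ g)).
  apply: le_trans (nondecreasing_cvgn_le _ (D_cvg g) (2 * n)%N); last first.
    by apply: nondecreasing_series => j _ _; exact: D_ge0.
  rewrite seriesEnat /= (_ : n%:R = \sum_(0 <= j < 2 * n) 2^-1).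
    rewrite !big_mkord; apply: ler_sum => j _; rewrite /D.
    have : cmod (phi (sigma j) g) < 2^-1.
      by rewrite ltNge; apply/negP => le_j; apply: h; exists j => //=; exact: ltn_ord.
    have := @cmod_ge0 R (phi (sigma j) g); rewrite -cmodE; nra.
  by rewrite sumr_const_nat subn0 -[RHS]mulr_natr natrM mulKf.
by rewrite leNgt (le_lt_trans (ler_norm _) lt_n).
Qed.
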